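(* Let $(V_\lambda)_{\lambda\in\Lambda}$ be a row coisometry on the Hilbert space $\mathcal K$ with Cuntz dilation $(S_\lambda)_{\lambda\in\Lambda}$ on $\mathcal H\supseteq\mathcal K$. Let $T,T'\in\mathcal B(\mathcal K)^{\boldsymbol\sigma}$ and let $A$ and $A'$, respectively, be the associated operators in the commutant of the Cuntz dilation, so $T=P_{\mathcal K}AP_{\mathcal K}$ and $T'=P_{\mathcal K}A'P_{\mathcal K}$. Then $AA'$ is also in the commutant of the Cuntz dilation, so $T\ast T':=P_{\mathcal K}AA'P_{\mathcal K}$ is an element of $\mathcal B(\mathcal K)^{\boldsymbol\sigma}$. Moreover, $$(P_{\mathcal K_m}AP_{\mathcal K_m})(P_{\mathcal K_m}A'P_{\mathcal K_m})\xi\to AA'\xi\quad\text{as } m\to\infty\qquad(\xi\in\mathcal H),$$ and $$(T\ast T')\xi=\lim_{m\to\infty}\sum_{|\lambda|=m}V_\lambda TT'V_\lambda^*\xi\qquad(\xi\in\mathcal K).$$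
   Context: $\Lambda$ is a finite set with $|\Lambda|=N\ge2$. A row coisometry on $\mathcal K$ is a family of bounded operators $(V_\lambda)_{\lambda\in\Lambda}$ with $\sum_\lambda V_\lambda V_\lambda^*=I_{\mathcal K}$. A representation of the Cuntz algebra $\mathcal O_N$ is a family of isometries $(S_\lambda)_{\lambda\in\Lambda}$ with $S_\lambda^*S_{\lambda'}=\delta_{\lambda\lambda'}I$ and $\sum_\lambda S_\lambda S_\lambda^*=I$. The Cuntz dilation of $(V_\lambda)$ is the representation $(S_\lambda)$ of $\mathcal O_N$, unique up to unitary equivalence, on a Hilbert space $\mathcal H\supseteq\mathcal K$ such that $S_\lambda^*\mathcal K\subseteq\mathcal K$, $S_\lambda^*|_{\mathcal K}=V_\lambda^*$ for all $\lambda$, and $\mathcal K$ is cyclic for the representation. $\mathcal B(\mathcal K)^{\boldsymbol\sigma}=\{A\in\mathcal B(\mathcal K):\sum_{\lambda\in\Lambda}V_\lambda AV_\lambda^*=A\}$. It is known (Bratteli–Jorgensen–Kishimoto) that $A'\mapsto P_{\mathcal K}A'P_{\mathcal K}$ is an isometric order isomorphism from the commutant of the representation $(S_\lambda)$ onto $\mathcal B(\mathcal K)^{\boldsymbol\sigma}$, where $P_{\mathcal K}$ is the orthogonal projection onto $\mathcal K$ (operators on $\mathcal K$ being identified with operators on $\mathcal H$ vanishing on $\mathcal K^\perp$). For a word $\lambda=\lambda_1\dots\lambda_m$ over $\Lambda$, $|\lambda|=m$, $V_\lambda=V_{\lambda_1}\cdots V_{\lambda_m}$ and $S_\lambda=S_{\lambda_1}\cdots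 S_{\lambda_m}$. $\mathcal K_m=\overline{\operatorname{span}}\{S_{\lambda}k:k\in\mathcal K,\ |\lambda|=m\}$ for $m\in\mathbb N$, $\mathcal K_0=\mathcal K$, and $P_{\mathcal K_m}$ is the orthogonal projection onto $\mathcal K_m$. *)

(* Defs.v *)
From HB Require Import structures.
From mathcomp Require Import all_boot all_order all_algebra.
From mathcomp Require Import boolp classical_sets reals topology normedtype.
From mathcomp Require Import sequences.
From mathcomp Require Import complex.

Set Implicit Arguments.
Unset Strict Implicit.
Unset Printing Implicit Defensive.

Import Order.TTheory GRing.Theory Num.Theory.
Import numFieldNormedType.Exports.

Local Open Scope classical_set_scope.
Local Open Scope ring_scope.

(* The scalars are meant to be [R[i]] with [R : realType].  The inner product is
   linear in its first argument; [inner_norm] makes it positive definite. *)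
HB.mixin Record isHilbert (C : numClosedFieldType) T
    of CompleteNormedModule C T := {
  inner : T -> T -> C;
  inner_scalar : forall y : T, scalar (inner^~ y);
  inner_conj : forall x y : T, inner x y = (inner y x)^*;
  inner_norm : forall x : T, inner x x = `|x| ^+ 2
}.

#[short(type="hilbertType")]
HB.structure Definition Hilbert (C : numClosedFieldType) :=
  {T of CompleteNormedModule C T & isHilbert C T}.

Section Operators.
Context {C : numClosedFieldType}.
Implicit Types U W : hilbertType C.

Definition bounded_operator {U W} (A : U -> W) : Prop :=
  linear A /\ exists M : C, forall x, `|A x| <= M * `|x|.

Definition isometric {U W} (A : U -> W) : Prop := forall x, `|A x| = `|x|.

(* By the Riesz representation theorem a bounded [A] has exactly one such [B];
   the default value is only reached by operators that are not bounded. *)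
Definition adj {U W} (A : U -> W) : W -> U :=
  xget (fun=> 0) [set B | forall x y, inner (A x) y = inner x (B y)].

Definition lspan {U} (X : set U) : set U :=
  [set x | exists (n : nat) (c : 'I_n -> C) (v : 'I_n -> U),
     (forall i, X (v i)) /\ x = \sum_(i < n) c i *: v i].

(* For a closed subspace [M], the projection theorem gives exactly one such
   [p]; no other [M] occurs below. *)
Definition orth_proj {U} (M : set U) (x : U) : U :=
  xget 0 [set p | M p /\ forall y, M y -> inner (x - p) y = 0].

End Operators.

Section Cuntz.
Context {C : numClosedFieldType} {Lam : finType}.
Implicit Types U K H : hilbertType C.

Definition row_coisometry {K} (V : Lam -> K -> K) : Prop :=
  (forall l, bounded_operator (V l)) /\
  (forall x, \sum_l V l (adj (V l) x) = x).

Definition cuntz_family {H} (S : Lam -> H -> H) : Prop :=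
  [/\ forall l, bounded_operator (S l) /\ isometric (S l),
      forall l l' x, adj (S l) (S l' x) = (l == l')%:R *: x
    & forall x, \sum_l S l (adj (S l) x) = x].

Definition word {U} (V : Lam -> U -> U) (w : seq Lam) : U -> U :=
  foldr (fun l A => V l \o A) idfun w.

(* Words in the generators ([true]) and in their adjoints ([false]); their
   linear combinations form a dense *-subalgebra of the image of the Cuntz
   algebra. *)
Definition star_word {H} (S : Lam -> H -> H) (w : seq (bool * Lam)) : H -> H :=
  foldr (fun bl A => (if bl.1 then S bl.2 else adj (S bl.2)) \o A) idfun w.

Definition cyclic_subspace {H} (S : Lam -> H -> H) (M : set H) : Prop :=
  closure (lspan [set x | exists w k, M k /\ x = star_word S w k]) = setT.

(* The inclusion of K in H is an isometric linear map [iota]. *)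
Definition cuntz_dilation {K H} (V : Lam -> K -> K) (iota : K -> H)
    (S : Lam -> H -> H) : Prop :=
  [/\ linear iota /\ isometric iota,
      cuntz_family S,
      forall l k, adj (S l) (iota k) = iota (adj (V l) k)
    & cyclic_subspace S (range iota)].

Definition commutant {H} (S : Lam -> H -> H) : set (H -> H) :=
  [set A | bounded_operator A /\
     forall l x, A (S l x) = S l (A x) /\ A (adj (S l) x) = adj (S l) (A x)].

(* B(K)^sigma *)
Definition fixed_operators {K} (V : Lam -> K -> K) : set (K -> K) :=
  [set T | bounded_operator T /\
     forall x, \sum_l V l (T (adj (V l) x)) = T x].

(* The operator on H that is [T] on K and vanishes on the orthogonal complement
   of K; since [iota] is injective, [T] is determined by it. *)
Definition ext_op {K H} (iota : K -> H) (T : K -> K) : H -> H :=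
  iota \o T \o adj iota.

(* K_m; for [m = 0] this is the range of [iota], which is already a closed
   subspace. *)
Definition word_space {K H} (iota : K -> H) (S : Lam -> H -> H) (m : nat) :
    set H :=
  closure (lspan [set x | exists (w : m.-tuple Lam) k,
                            x = word S w (iota k)]).

End Cuntz.

(* Main.v *)
(* Let J be the adjoint of iota. The projections Q_m onto K_m satisfy
   Q_0 = iota J and Q_(m+1) = sum_l S_l Q_m S_l^*, hence
   S_l Q_m = Q_(m+1) S_l and Q_m S_l^* = S_l^* Q_(m+1). Every vector
   S_w iota(k), w a word in the S_l and S_l^*, is therefore fixed by Q_m for all
   large m, so cyclicity and contractivity give Q_m -> I strongly, which yields
   the first limit. As J S_l = V_l J and S_l^* iota = iota V_l^*, writing
   T = J A iota and T' = J A' iota gives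
   sum_(|w| = m) V_w T T' V_w^* = J A Q_m A' iota, which converges strongly to
   J A A' iota. *)
Require Import Defs.
From HB Require Import structures.
From mathcomp Require Import all_boot all_order all_algebra.
From mathcomp Require Import boolp classical_sets reals topology normedtype.
From mathcomp Require Import sequences complex.
From mathcomp Require Import ring.

Set Implicit Arguments.
Unset Strict Implicit.
Unset Printing Implicit Defensive.

Import Order.TTheory GRing.Theory Num.Theory.
Import numFieldNormedType.Exports.

Local Open Scope classical_set_scope.
Local Open Scope ring_scope.

(** * Linear maps given as plain functions *)

Section LinearMaps.
Context {C : numClosedFieldType} {U W : lmodType C} (f : U -> W).
Hypothesis linf : linear f.

Let g : {linear U -> W} := HB.pack f (GRing.isLinear.Build _ _ _ _ f linf).

Lemma linear_fun0 : f 0 = 0.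
Proof. exact: (linear0 g). Qed.

Lemma linear_funB x y : f (x - y) = f x - f y.
Proof. exact: (linearB g). Qed.

Lemma linear_funZ a x : f (a *: x) = a *: f x.
Proof. exact: (linearZ_LR g). Qed.

Lemma linear_fun_sum (I : Type) (r : seq I) (P : pred I) (F : I -> U) :
  f (\sum_(i <- r | P i) F i) = \sum_(i <- r | P i) f (F i).
Proof. exact: (linear_sum g). Qed.

End LinearMaps.

(** * Sesquilinearity and the Cauchy-Schwarz inequality *)

Section InnerProduct.
Context {C : numClosedFieldType} {U : hilbertType C}.
Implicit Types x y z : U.

Lemma innerDl x y z : inner (x + y) z = inner x z + inner y z.
Proof. by have := inner_scalar z 1 x y; rewrite /= scale1r mul1r. Qed.

Lemma inner0l z : inner 0 z = 0.
Proof. by apply: (addrI (inner 0 z)); rewrite -innerDl !addr0. Qed.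

Lemma innerZl c x z : inner (c *: x) z = c * inner x z.
Proof. by have := inner_scalar z c x 0; rewrite /= !addr0 inner0l addr0. Qed.

Lemma innerNl x z : inner (- x) z = - inner x z.
Proof. by rewrite -scaleN1r innerZl mulN1r. Qed.

Lemma innerBl x y z : inner (x - y) z = inner x z - inner y z.
Proof. by rewrite innerDl innerNl. Qed.

Lemma inner0r z : inner z 0 = 0.
Proof. by rewrite inner_conj inner0l conjC0. Qed.

Lemma innerDr x y z : inner z (x + y) = inner z x + inner z y.
Proof. by rewrite inner_conj innerDl rmorphD /= -!inner_conj. Qed.

Lemma innerZr c x z : inner z (c *: x) = c^* * inner z x.
Proof. by rewrite inner_conj innerZl rmorphM /= -inner_conj. Qed.

Lemma innerNr x z : inner z (- x) = - inner z x.
Proof. by rewrite inner_conj innerNl rmorphN /= -inner_conj. Qed.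

Lemma innerBr x y z : inner z (x - y) = inner z x - inner z y.
Proof. by rewrite innerDr innerNr. Qed.

Lemma inner_self_eq0 x : inner x x = 0 -> x = 0.
Proof. by rewrite inner_norm => /eqP; rewrite expf_eq0 /= normr_eq0 => /eqP. Qed.

Lemma inner_ext x y : (forall z, inner z x = inner z y) -> x = y.
Proof.
move=> e; apply/eqP; rewrite -subr_eq0; apply/eqP/inner_self_eq0.
by rewrite innerBr e subrr.
Qed.

Lemma sqr_normD x y :
  `|x + y| ^+ 2 = `|x| ^+ 2 + `|y| ^+ 2 + (inner x y + (inner x y)^*).
Proof.
by rewrite -!inner_norm !innerDl !innerDr (inner_conj y x); ring.
Qed.

Lemma sqr_normB x y :
  `|x - y| ^+ 2 = `|x| ^+ 2 + `|y| ^+ 2 - (inner x y + (inner x y)^*).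
Proof. by rewrite sqr_normD innerNr normrN rmorphN /= opprD. Qed.

Lemma cauchy_schwarz x y : `|inner x y| <= `|x| * `|y|.
Proof.
have [->|y0] := eqVneq y 0; first by rewrite inner0r !normr0 mulr0.
have ny0 : 0 < `|y| ^+ 2 by rewrite exprn_gt0 // normr_gt0.
(* The vector is [|y|^2] times the component of [x] orthogonal to [y]; scaling by [|y|^2] avoids a
   division. *)
have e : `| (`|y| ^+ 2) *: x - inner x y *: y | ^+ 2 =
   `|y| ^+ 2 * ((`|x| * `|y|) ^+ 2 - `|inner x y| ^+ 2).
  rewrite sqr_normB innerZl innerZr !normrZ !normr_id.
  rewrite !rmorphM /= conjCK.
  by rewrite (CrealP (normr_real y)) !exprMn normCK; ring.
have : 0 <= `|y| ^+ 2 * ((`|x| * `|y|) ^+ 2 - `|inner x y| ^+ 2).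
  by rewrite -e exprn_ge0.
by rewrite pmulr_rge0 // subr_ge0 ler_pXn2r // nnegrE ?mulr_ge0.
Qed.

End InnerProduct.

(** The bound in [bounded_operator] is an arbitrary scalar, possibly not even real when [b = 0]; but
    [M * b] lies above [a], so it is a nonnegative real and equals its own norm. *)
Lemma ler_norm_mulr (C : numDomainType) (a M b : C) :
  0 <= a -> 0 <= b -> a <= M * b -> a <= `|M| * b.
Proof.
move=> a0 b0 le_a; apply: (le_trans le_a).
have Mb : M * b \is Num.real by rewrite ger0_real // (le_trans a0).
by apply: (le_trans (real_ler_norm Mb)); rewrite normrM (ger0_norm b0).
Qed.

(** * The Riesz representation theorem *)

Section Riesz.
Context {R : realType} {U : hilbertType R[i]}.

(** The order of [R[i]] is only partial, so the infimum is taken in [R] over the real parts and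
    embedded back. *)
Lemma real_lbound_infimum (X : Type) (phi : X -> R[i]) (x0 : X) (b : R[i]) :
  (forall x, phi x \is Num.real) -> b \is Num.real -> (forall x, b <= phi x) ->
  exists m : R[i], (forall x, m <= phi x) /\
    (forall e, 0 < e -> exists x, phi x < m + e).
Proof.
move=> rphi rb bphi.
have RE (z : R[i]) : z \is Num.real -> z = (complex.Re z)%:C%C.
  by move=> rz; rewrite RRe_real.
set E := [set complex.Re (phi x) | x in setT].
have hE : has_inf E.
  split; first by exists (complex.Re (phi x0)), x0.
  exists (complex.Re b) => _ [x _ <-].
  by rewrite -lecR -!RE.
exists (inf E)%:C%C; split=> [x|e e0].
  rewrite [leRHS]RE // lecR; apply: ge_inf; first exact: hE.2.
  by exists x.
have eE := RE e (gtr0_real e0).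
have e0' : 0 < complex.Re e by rewrite -ltcR -eE.
have [_ [x _ <-] lt] := inf_adherent e0' hE.
by exists x; rewrite [ltLHS]RE // eE -rmorphD ltcR.
Qed.

Variables (f : U -> R[i]) (M : R[i]).
Hypotheses (linf : scalar f) (bndf : forall x, `|f x| <= M * `|x|).

Let fD x y : f (x + y) = f x + f y.
Proof. by have := linf 1 x y; rewrite scale1r mul1r. Qed.

Let fZ c x : f (c *: x) = c * f x.
Proof.
have f0 : f 0 = 0 by apply: (addrI (f 0)); rewrite -fD !addr0.
by have := linf c x 0; rewrite !addr0 f0 addr0.
Qed.

(** If [f] is the inner product with [z], this equals [|x - z|^2 - |z|^2], whose only minimizer is
    [z]. *)
Let phi x : R[i] := `|x| ^+ 2 - (f x + (f x)^*).

Let phi_real x : phi x \is Num.real.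
Proof.
by rewrite rpredB ?rpredX ?normr_real // CrealE rmorphD /= conjCK addrC.
Qed.

Let re_le (z : R[i]) : z + z^* <= 2 * `|z|.
Proof.
have h : z + z^* \is Num.real by rewrite CrealE rmorphD /= conjCK addrC.
apply: (le_trans (real_ler_norm h)); apply: (le_trans (ler_normD _ _)).
by rewrite norm_conjC mulr_natl.
Qed.

Let phi_parallelogram x y :
  `|x - y| ^+ 2 = 2 * phi x + 2 * phi y - 4 * phi (2^-1 *: (x + y)).
Proof.
rewrite /phi !fZ !fD normrZ exprMn sqr_normB sqr_normD !rmorphM !rmorphD /=.
have -> : (2^-1 : R[i])^* = 2^-1 by rewrite fmorphV /= rmorph_nat.
rewrite normfV normr_nat.
by field.
Qed.

Let phi_lbound x : - `|M| ^+ 2 <= phi x.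
Proof.
have h : f x + (f x)^* <= 2 * (`|M| * `|x|).
  apply: (le_trans (re_le _)); rewrite ler_pM2l //.
  apply: (le_trans (real_ler_norm (normr_real (f x)))); rewrite normr_id.
  exact: ler_norm_mulr (bndf x).
rewrite -subr_ge0 /phi opprK addrAC.
rewrite subr_ge0; apply: (le_trans h); rewrite -subr_ge0.
have -> : `|x| ^+ 2 + `|M| ^+ 2 - 2 * (`|M| * `|x|) = (`|x| - `|M|) ^+ 2 by ring.
by rewrite real_exprn_even_ge0 // rpredB ?normr_real.
Qed.

(* A functional f is represented by the minimizer of |x|^2 - 2 Re f(x): by the
   parallelogram law the sets of approximate minimizers form a Cauchy filter. *)
Lemma riesz_representation : exists z, forall x, f x = inner x z.
Proof.
have rM : - `|M| ^+ 2 \is Num.real by rewrite rpredN rpredX ?normr_real.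
have [m [lem ltm]] := real_lbound_infimum 0 phi_real rM phi_lbound.
pose F := filter_from [set e : R[i] | 0 < e] (fun e => [set x | phi x < m + e]).
have FF : ProperFilter F.
  apply: filter_from_proper => [|e /= e0]; last first.
    by have [x xe] := ltm e e0; exists x.
  apply: filter_from_filter; first by exists 1 => /=.
  move=> i j /= i0 j0.
  have [ij|ji] := real_leP (gtr0_real i0) (gtr0_real j0).
    by exists i => // x /= xi; split => //=; rewrite (lt_le_trans xi) // lerD2l.
  exists j => // x /= xj; split => //=.
  by rewrite (lt_le_trans xj) // lerD2l ltW.
have cF : cauchy F.
  apply: cauchy_exP => e e0.
  (* Since [phi] is at least [m] at the midpoint, [phi_parallelogram] puts two points with
     [phi < m + d] at squared distance below [4 * d]; hence [d = e ^+ 2 / 4]. *)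
  have d0 : 0 < e ^+ 2 / 4 by rewrite divr_gt0 // exprn_gt0.
  have [x xd] := ltm _ d0; exists x; exists (e ^+ 2 / 4) => //= y yd.
  rewrite -ball_normE /= -(@ltr_pXn2r _ 2) ?nnegrE ?(ltW e0) //.
  rewrite phi_parallelogram.
  have -> : e ^+ 2 = 2 * (m + e ^+ 2 / 4) + 2 * (m + e ^+ 2 / 4) - 4 * m by field.
  by rewrite ltr_leB // ?ltrD ?ltr_pM2l // ler_pM2l.
have cvF : cvg F by apply/cauchy_cvgP.
pose z : U := lim F.
exists z => h0.
have Fz e : 0 < e -> exists2 x, `|z - x| < e & phi x < m + e.
  move=> e0.
  have F1 : F (ball z e) by apply: cvF; apply: nbhsx_ballx.
  have F2 : F [set x | phi x < m + e] by exists e.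
  have [x [x1 x2]] := filter_ex (filterI F1 F2).
  by exists x => //; rewrite -ball_normE in x1.
(* First-order condition: compare phi x and phi (x + h) for near-minimizers x. *)
have D_ge h : 0 <= `|h| ^+ 2 + ((inner h z - f h) + (inner h z - f h)^*).
  apply/ler_addgt0Pr => e e0.
  (* Of the [1 + 2|h|] shares of [e], one pays for [x] being only nearly minimal and [2|h|] pay for
     the cross term with [x - z]. *)
  have h1 : 0 < 1 + 2 * `|h| by rewrite ltr_wpDr // mulr_ge0.
  have [x xz xe] := Fz _ (divr_gt0 e0 h1).
  have := lem (x + h).
  have -> : phi (x + h) = phi x +
    (`|h| ^+ 2 + ((inner h z - f h) + (inner h z - f h)^*)) +
    (inner h (x - z) + (inner h (x - z))^*).
    rewrite /phi sqr_normD fD innerBr !rmorphB !rmorphD /= (inner_conj x h) conjCK.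
    by ring.
  set D := `|h| ^+ 2 + _ => le_m.
  rewrite -(lerD2l m) addr0; apply: (le_trans le_m).
  have -> : m + (D + e) = m + e / (1 + 2 * `|h|) + D +
    2 * (`|h| * (e / (1 + 2 * `|h|))) by field; rewrite gt_eqF.
  apply: lerD; first by rewrite lerD2r ltW.
  apply: (le_trans (re_le _)); rewrite ler_pM2l //.
  apply: (le_trans (cauchy_schwarz _ _)).
  by rewrite ler_wpM2l // distrC ltW.
set d := inner h0 z - f h0.
suff : d == 0 by rewrite subr_eq0 => /eqP.
have k0 : 0 < 1 + `|h0| ^+ 2 by rewrite ltr_wpDr // exprn_ge0.
(* A short step along [h0] against [d]: the first-order term outweighs the quadratic one, and the
   total is a negative multiple of [|d|^2]. *)
have := D_ge (- (d^* / (1 + `|h0| ^+ 2)) *: h0).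
rewrite innerZl fZ -mulrBr -/d normrZ.
have -> : `|- (d^* / (1 + `|h0| ^+ 2))| = `|d| / (1 + `|h0| ^+ 2).
  by rewrite normrN normf_div norm_conjC (gtr0_norm k0).
have -> : (- (d^* / (1 + `|h0| ^+ 2)) * d)^* = - (d^* / (1 + `|h0| ^+ 2)) * d.
  rewrite rmorphM rmorphN /= fmorph_div /= conjCK (CrealP (gtr0_real k0)).
  by field; rewrite gt_eqF.
have -> : (`|d| / (1 + `|h0| ^+ 2) * `|h0|) ^+ 2 +
   (- (d^* / (1 + `|h0| ^+ 2)) * d + - (d^* / (1 + `|h0| ^+ 2)) * d) =
   - (`|d| ^+ 2 * ((2 + `|h0| ^+ 2) / (1 + `|h0| ^+ 2) ^+ 2)).
  by rewrite !exprMn (normCK d); field; rewrite gt_eqF.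
rewrite oppr_ge0 pmulr_lle0; last first.
  by rewrite divr_gt0 ?exprn_gt0 // ltr_wpDr // exprn_ge0.
move=> d2; have : `|d| ^+ 2 == 0 by rewrite eq_le d2 exprn_ge0.
by rewrite expf_eq0 normr_eq0.
Qed.

End Riesz.

(** * Linear spans, closures and orthogonal projections *)

Section LinearSpan.
Context {C : numClosedFieldType}.
Implicit Types U W : hilbertType C.

Lemma lspan_gen U (X : set U) x : X x -> lspan X x.
Proof.
move=> Xx; exists 1%N, (fun=> 1), (fun=> x); split=> //.
by rewrite big_ord1 scale1r.
Qed.

Lemma lspan0 U (X : set U) : lspan X 0.
Proof.
exists 0%N, (fun=> 0), (fun=> 0); split; last by rewrite big_ord0.
by case.
Qed.

Lemma lspanD U (X : set U) x y : lspan X x -> lspan X y -> lspan X (x + y).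
Proof.
move=> [n [c [v [Xv ->]]]] [p [d [w [Xw ->]]]].
exists (n + p)%N,
  (fun i => match fintype.split i with inl j => c j | inr j => d j end),
  (fun i => match fintype.split i with inl j => v j | inr j => w j end).
split=> [i|]; first by case: (fintype.split i).
rewrite big_split_ord /=; congr (_ + _); apply: eq_bigr => i _.
  by rewrite -[lshift _ _]/(unsplit (inl i)) unsplitK.
by rewrite -[rshift _ _]/(unsplit (inr i)) unsplitK.
Qed.

Lemma lspan_sum U (X : set U) (I : finType) (F : I -> U) :
  (forall i, lspan X (F i)) -> lspan X (\sum_i F i).
Proof.
move=> XF; elim/big_ind: _ => // [|x y]; [exact: lspan0 | exact: lspanD].
Qed.

Lemma lspan_map U W (X : set U) (Y : set W) (f : U -> W) x :
  linear f -> (forall u, X u -> Y (f u)) -> lspan X x -> lspan Y (f x).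
Proof.
move=> lf XY [n [c [v [Xv ->]]]]; exists n, c, (f \o v); split.
  by move=> i; exact/XY/Xv.
rewrite (linear_fun_sum lf); apply: eq_bigr => i _.
exact: linear_funZ.
Qed.

Lemma lspan_min U (X E : set U) :
  E 0 -> (forall a u v, E u -> E v -> E (a *: u + v)) ->
  X `<=` E -> lspan X `<=` E.
Proof.
move=> E0 ED XE _ [n [c [v [Xv ->]]]]; elim/big_rec: _ => // i u _ Eu.
by apply: ED => //; exact/XE/Xv.
Qed.

(** For [x] in [X] close to [y], [inner d y = inner d (y - x)], which is small by Cauchy-Schwarz. *)
Lemma inner_closure_eq0 U (X : set U) d y :
  (forall x, X x -> inner d x = 0) -> closure X y -> inner d y = 0.
Proof.
move=> dX Xy; apply/eqP; rewrite -normr_le0; apply/ler_addgt0Pr => e e0.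
have d1 : 0 < 1 + `|d| by rewrite ltr_wpDr.
have [x [Xx xy]] := Xy _ (nbhsx_ballx y _ (divr_gt0 e0 d1)).
rewrite -ball_normE /= in xy.
rewrite add0r -(subrK x y) innerDr (dX _ Xx) addr0.
apply: (le_trans (cauchy_schwarz _ _)).
have -> : e = (1 + `|d|) * (e / (1 + `|d|)) by field; rewrite gt_eqF.
by apply: ler_pM => //; [rewrite lerDr | exact: ltW].
Qed.

(** For two candidates [p] and [q], the difference [q - p = (x - p) - (x - q)] is orthogonal to both
    [p] and [q], hence to itself. *)
Lemma orth_projE U (M : set U) x p :
  M p -> (forall y, M y -> inner (x - p) y = 0) -> orth_proj M x = p.
Proof.
move=> Mp xp; apply: xget_unique => // q [Mq xq].
apply/eqP; rewrite -subr_eq0; apply/eqP/inner_self_eq0.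
have {1}-> : q - p = (x - p) - (x - q) by rewrite opprB [RHS]addrC subrKA.
by rewrite innerBl !innerBr xp // xp // xq // xq // !subr0.
Qed.

End LinearSpan.

(** * Adjoints and bounded operators *)

Section Adjoints.
Context {C : numClosedFieldType}.
Implicit Types U W X : hilbertType C.

(** Relational form of the adjoint, symmetric and compatible with composition; [adj_eq] passes from
    it to [adj] by uniqueness. *)
Definition is_adj U W (A : U -> W) (B : W -> U) :=
  forall x y, inner (A x) y = inner x (B y).

Lemma is_adj_sym U W (A : U -> W) B : is_adj A B -> is_adj B A.
Proof. by move=> AB x y; rewrite inner_conj -AB -inner_conj. Qed.

Lemma is_adj_comp U W X (A : U -> W) B (A' : W -> X) B' :
  is_adj A B -> is_adj A' B' -> is_adj (A' \o A) (B \o B').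
Proof. by move=> AB AB' x y; rewrite /= AB' AB. Qed.

Lemma is_adj_id U : is_adj (@idfun U) idfun.
Proof. by []. Qed.

Lemma adj_eq U W (A : U -> W) B : is_adj A B -> adj A = B.
Proof.
move=> AB; apply: xget_unique => // B' AB'.
by apply/funext => y; apply: inner_ext => x; rewrite -AB -AB'.
Qed.

Lemma is_adj_linear U W (A : U -> W) B : is_adj A B -> linear B.
Proof.
move=> AB a u v; apply: inner_ext => x.
by rewrite -AB !innerDr !innerZr !AB.
Qed.

Lemma bounded_operator_ge0 U W (A : U -> W) : bounded_operator A ->
  exists2 M : C, 0 <= M & forall x, `|A x| <= M * `|x|.
Proof.
by move=> [_ [M AM]]; exists `|M| => // x; apply: ler_norm_mulr.
Qed.

Lemma bounded_operator_comp U W X (A : W -> X) (B : U -> W) :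
  bounded_operator A -> bounded_operator B -> bounded_operator (A \o B).
Proof.
move=> Ab Bb; split.
  by move=> a u v /=; rewrite (Bb.1 a u v) (Ab.1 a).
have [M M0 AM] := bounded_operator_ge0 Ab.
have [N N0 BN] := bounded_operator_ge0 Bb.
exists (M * N) => x /=; apply: (le_trans (AM _)).
by rewrite -mulrA ler_wpM2l.
Qed.

Lemma bounded_operator_cvg U W (A : U -> W) (u : nat -> U) (y : U) :
  bounded_operator A -> u @ \oo --> y -> A \o u @ \oo --> A y.
Proof.
move=> Ab uy; have [M M0 AM] := bounded_operator_ge0 Ab.
apply/cvgrPdist_lt => e e0; have M1 : 0 < 1 + M by rewrite ltr_wpDr.
have /cvgrPdist_lt/(_ _ (divr_gt0 e0 M1)) := uy.
apply: filterS => n ltn /=; rewrite -(linear_funB Ab.1).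
apply: (le_lt_trans (AM _)).
have -> : e = (1 + M) * (e / (1 + M)) by field; rewrite gt_eqF.
by apply: ltr_pM => //; rewrite ltrDr.
Qed.

End Adjoints.

(** Riesz represents each functional [inner (A x) y] of [x]; choice over [y] assembles an adjoint,
    so [adj A] is not the default value. *)
Lemma bounded_is_adj (R : realType) (U W : hilbertType R[i]) (A : U -> W) :
  bounded_operator A -> is_adj A (adj A).
Proof.
move=> Ab.
have ex y : exists z, forall x, inner (A x) y = inner x z.
  have [M M0 AM] := bounded_operator_ge0 Ab.
  apply: (@riesz_representation _ _ (fun x => inner (A x) y) (M * `|y|)).
    by move=> a u v; rewrite Ab.1 innerDl innerZl.
  move=> x; apply: (le_trans (cauchy_schwarz _ _)).
  by rewrite mulrAC ler_wpM2r.
have [B AB] := choice ex.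
by rewrite (adj_eq (fun x y => AB y x)) => x y.
Qed.

Lemma sum_tuple_cons (U : nmodType) (Lam : finType) m (F : seq Lam -> U) :
  \sum_(w : m.+1.-tuple Lam) F w =
  \sum_l \sum_(w : m.-tuple Lam) F (l :: w).
Proof.
rewrite pair_big /=.
rewrite (reindex (fun p : Lam * m.-tuple Lam => [tuple of p.1 :: p.2])) //=.
exists (fun t : m.+1.-tuple Lam => (thead t, [tuple of behead t])).
  by move=> [l w] _ /=; congr pair; apply: val_inj.
by move=> t _; rewrite [RHS]tuple_eta.
Qed.

(** Equality case of Cauchy-Schwarz: [inner x (B (A x)) = |x|^2] while [|B (A x)| <= |x|], so
    expanding [|x - B (A x)|^2] gives at most 0. *)
Lemma isometric_adj_cancel (C : numClosedFieldType) (U W : hilbertType C)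
    (A : U -> W) B : is_adj A B -> isometric A -> cancel A B.
Proof.
move=> AB isoA x.
have AA : inner x (B (A x)) = `|x| ^+ 2 by rewrite -AB inner_norm isoA.
have le_B : `|B (A x)| <= `|x|.
  have [->|B0] := eqVneq (B (A x)) 0; first by rewrite normr0.
  rewrite -(@ler_pM2r _ `|B (A x)|) ?normr_gt0 // -expr2 -inner_norm -AB.
  apply: (le_trans (real_ler_norm _)).
    by rewrite AB inner_norm rpredX ?normr_real.
  by apply: (le_trans (cauchy_schwarz _ _)); rewrite !isoA mulrC.
apply/esym/eqP; rewrite -subr_eq0 -normr_eq0 -sqrf_eq0 eq_le.
rewrite exprn_ge0 // andbT sqr_normB AA rmorphXn /= (CrealP (normr_real x)).
by rewrite opprD addrACA subrr add0r subr_le0 ler_pXn2r ?nnegrE.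
Qed.

(** * Relations between the dilation and the row coisometry *)

Section Dilation.
Context {R : realType} {Lam : finType} {K H : hilbertType R[i]}.
Variables (V : Lam -> K -> K) (iota : K -> H) (S : Lam -> H -> H).
Hypothesis Vbnd : forall l, bounded_operator (V l).
Hypothesis dil : cuntz_dilation V iota S.

Let J := adj iota.
Let Sa l := adj (S l).

Let Vadj l : is_adj (V l) (adj (V l)).
Proof. exact: bounded_is_adj. Qed.

Let Sadj l : is_adj (S l) (Sa l).
Proof. by apply: bounded_is_adj; have [_ [+ _ _] _ _] := dil => /(_ l) []. Qed.

Let Jadj : is_adj iota J.
Proof.
have [[lin iso] _ _ _] := dil; apply: bounded_is_adj; split=> //.
by exists 1 => x; rewrite iso mul1r.
Qed.

Let linS l : linear (S l).
Proof. exact: is_adj_linear (is_adj_sym (Sadj l)). Qed.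

Let linSa l : linear (Sa l).
Proof. exact: is_adj_linear (Sadj l). Qed.

Let lin_iota : linear iota.
Proof. exact: is_adj_linear (is_adj_sym Jadj). Qed.

Let linJ : linear J.
Proof. exact: is_adj_linear Jadj. Qed.

Let SaS l l' x : Sa l (S l' x) = (l == l')%:R *: x.
Proof. by have [_ [_ + _] _ _] := dil; apply. Qed.

Let sumSSa x : \sum_l S l (Sa l x) = x.
Proof. by have [_ [_ _ +] _ _] := dil; apply. Qed.

Let Sa_iota l k : Sa l (iota k) = iota (adj (V l) k).
Proof. by have [_ _ + _] := dil; apply. Qed.

Lemma adj_iotaK : cancel iota J.
Proof. by apply: isometric_adj_cancel => //; have [[]] := dil. Qed.

Lemma adj_iota_S l x : J (S l x) = V l (J x).
Proof.
apply: inner_ext => k; rewrite -Jadj -(is_adj_sym (Sadj l)) Sa_iota Jadj.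
by rewrite (is_adj_sym (Vadj l)).
Qed.

(** * The projections onto [K_m] and their strong limit *)

Lemma orth_proj_range x : orth_proj (range iota) x = iota (J x).
Proof.
apply: orth_projE; first by exists (J x).
move=> _ [k _ <-].
by rewrite innerBl Jadj adj_iotaK -(is_adj_sym Jadj) subrr.
Qed.

(** Explicit candidate for the projection onto [K_m]; the recursion makes its intertwining relations
    with the [S l] direct computations. [orth_proj_word_space] identifies it. *)
Fixpoint word_proj m : H -> H :=
  if m is n.+1 then fun x => \sum_l S l (word_proj n (Sa l x))
  else iota \o J.

Lemma linear_word_proj m : linear (word_proj m).
Proof.
elim: m => [|m IH] a u v /=; first by rewrite linJ lin_iota.
rewrite scaler_sumr -big_split; apply: eq_bigr => l _.
by rewrite linSa IH linS.
Qed.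

Lemma word_proj_S m l x : word_proj m.+1 (S l x) = S l (word_proj m x).
Proof.
rewrite /= (bigD1 l) //= big1 ?addr0 => [|l' l'l]; rewrite SaS.
  by rewrite eqxx scale1r.
by rewrite (negPf l'l) scale0r !linear_fun0 //; exact: linear_word_proj.
Qed.

Lemma adj_word_proj m l x : Sa l (word_proj m.+1 x) = word_proj m (Sa l x).
Proof.
rewrite /= (linear_fun_sum (linSa l)) (bigD1 l) //= big1 ?addr0 => [|l' l'l].
  by rewrite SaS eqxx scale1r.
by rewrite SaS eq_sym (negPf l'l) scale0r.
Qed.

(** K lies in every [K_m]: [iota k] is the sum of the [S l (iota (adj (V l) k))], and induction
    fixes each inner vector. *)
Lemma word_proj_iota m k : word_proj m (iota k) = iota k.
Proof.
elim: m k => [|m IH] k /=; first by rewrite adj_iotaK.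
by rewrite -[RHS]sumSSa; apply: eq_bigr => l _; rewrite Sa_iota IH.
Qed.

Let wordset m := [set x | exists (w : m.-tuple Lam) k, x = word S w (iota k)].

Lemma word_proj_lspan m x : lspan (wordset m) (word_proj m x).
Proof.
elim: m x => [|m IH] x.
  by apply: lspan_gen; exists [tuple], (J x).
apply: lspan_sum => l; apply: lspan_map (linS l) _ (IH _).
by move=> _ [w [k ->]]; exists [tuple of l :: w], k.
Qed.

(** It suffices to test on generators; moving the first letter of the word across the inner product
    lowers the level by one. *)
Lemma word_proj_orth m x y :
  word_space iota S m y -> inner (x - word_proj m x) y = 0.
Proof.
apply: inner_closure_eq0; apply: lspan_min.
- by rewrite /= inner0r.
- by move=> a u v /= eu ev; rewrite innerDr innerZr eu ev mulr0 addr0.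
move=> _ [w [k ->]] /=; elim: m w x => [|m IH] w x.
  by rewrite tuple0 /= innerBl Jadj adj_iotaK -(is_adj_sym Jadj) subrr.
case/tupleP: w => l w /=.
rewrite -(is_adj_sym (Sadj l)) (linear_funB (linSa l)) adj_word_proj.
exact: IH.
Qed.

Lemma orth_proj_word_space m x :
  orth_proj (word_space iota S m) x = word_proj m x.
Proof.
apply: orth_projE; last exact: word_proj_orth.
exact/subset_closure/word_proj_lspan.
Qed.

Lemma word_proj_le m x : `|word_proj m x| <= `|x|.
Proof.
rewrite -(@ler_pXn2r _ 2) ?nnegrE // -[in leRHS](subrK (word_proj m x) x).
rewrite sqr_normD word_proj_orth ?conjC0 ?addr0 ?lerDr ?exprn_ge0 //.
exact/subset_closure/word_proj_lspan.
Qed.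

Lemma star_word_word_proj w k : exists m0, forall m, (m0 <= m)%N ->
  word_proj m (star_word S w (iota k)) = star_word S w (iota k).
Proof.
elim: w => [|[b l] w [m0 IH]] /=.
  by exists 0%N => m _; exact: word_proj_iota.
(* An [S l] raises the index needed by one. An adjoint lowers it, so the same threshold serves
   both. *)
exists m0.+1; case: b => -[//|m] lem.
  exact: etrans (word_proj_S _ _ _) (congr1 (S l) (IH m lem)).
apply: etrans (esym (adj_word_proj _ _ _)) (congr1 (Sa l) (IH _ _)).
by do 2!apply: ltnW.
Qed.

Lemma word_proj_cvg x : (fun m => word_proj m x) @ \oo --> x.
Proof.
pose E := [set y | exists m0, forall m, (m0 <= m)%N -> word_proj m y = y].
have [_ _ _ cyc] := dil.
have : closure E x.
  have : [set: H] x by [].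
  rewrite -cyc; apply: closure_subset; apply: lspan_min.
  - by exists 0%N => m _; rewrite (linear_fun0 (linear_word_proj m)).
  - move=> a u v [m1 Eu] [m2 Ev]; exists (maxn m1 m2) => m.
    by rewrite geq_max linear_word_proj => /andP[/Eu-> /Ev->].
  by move=> _ [w [_ [[k _ <-] ->]]]; exact: star_word_word_proj.
move=> clx; apply/cvgrPdist_lt => e e0.
have e2 : 0 < e / 2 by rewrite divr_gt0.
have [y [[m0 Ey]]] := clx _ (nbhsx_ballx x _ e2).
rewrite -ball_normE /= => xy.
exists m0 => // m /= le_m.
(* As [y] is fixed, the error at [x] is that at [x - y], at most twice [|x - y|] by
   contractivity. *)
have -> : x - word_proj m x = (x - y) - word_proj m (x - y).
  by rewrite (linear_funB (linear_word_proj m)) Ey // opprB addrA subrK.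
rewrite [e]splitr; apply: (le_lt_trans (ler_normB _ _)).
by apply: ltrD => //; exact: le_lt_trans (word_proj_le _ _) xy.
Qed.

(** Contractivity uniform in [m] controls [word_proj m (y - u m)]; strong convergence at [y]
    controls the rest. *)
Lemma word_proj_cvg_seq (u : nat -> H) (y : H) :
  u @ \oo --> y -> (fun m => word_proj m (u m)) @ \oo --> y.
Proof.
move=> uy; apply/cvgrPdist_lt => e e0.
have e2 : 0 < e / 2 by rewrite divr_gt0.
have /cvgrPdist_lt/(_ _ e2) N1 := uy.
have /cvgrPdist_lt/(_ _ e2) N2 := @word_proj_cvg y.
apply: filterS2 N1 N2 => m d1 d2.
rewrite -(subrKA (word_proj m y)) [e]splitr.
apply: (le_lt_trans (ler_normD _ _)); apply: ltrD => //.
rewrite -(linear_funB (linear_word_proj m)).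
exact: le_lt_trans (word_proj_le _ _) d1.
Qed.

(** * Sums over words, and operators on K as compressions *)

Lemma is_adj_word w : is_adj (word V w) (adj (word V w)).
Proof.
elim: w => [|l w IH]; first by rewrite (adj_eq (@is_adj_id _ K)).
by rewrite /= (adj_eq (is_adj_comp IH (Vadj l))); exact: is_adj_comp.
Qed.

(** Adjoints reverse products, so the first letter of a word ends up outermost on both sides; this
    drives the induction on word length. *)
Lemma word_sum_cons m (T : K -> K) x :
  \sum_(w : m.+1.-tuple Lam) word V w (T (adj (word V w) x)) =
  \sum_l V l (\sum_(w : m.-tuple Lam)
    word V w (T (adj (word V w) (adj (V l) x)))).
Proof.
rewrite (sum_tuple_cons _ (fun w => word V w (T (adj (word V w) x)))).
apply: eq_bigr => l _; rewrite (linear_fun_sum (Vbnd l).1).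
apply: eq_bigr => w _ /=.
by rewrite (adj_eq (is_adj_comp (is_adj_word w) (Vadj l))).
Qed.

Lemma bounded_adj_iota : bounded_operator J.
Proof.
split=> //; exists 1 => x; rewrite mul1r.
(* As [iota] is isometric, [|J x| = |iota (J x)|], the norm of the projection of [x] onto K. *)
have [[_ <-] _ _ _] := dil.
exact: (word_proj_le 0).
Qed.

(** With [iota \o J] the projection onto K, cancelling [iota] by [J] turns identities between
    operators on H into identities on K. *)
Lemma ext_op_compression (A : H -> H) (B : K -> K) :
  ext_op iota B = orth_proj (range iota) \o A \o orth_proj (range iota) <->
  B = J \o A \o iota.
Proof.
split=> [eB|->].
  apply/funext => k; have := congr1 (fun f => J (f (iota k))) eB.
  by rewrite /ext_op /= !orth_proj_range -/J !adj_iotaK.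
by apply/funext => x; rewrite /ext_op /= !orth_proj_range.
Qed.

(** * Compressions of elements of the commutant *)

Section Compression.
Variables A A' : H -> H.
Hypotheses (cA : commutant S A) (cA' : commutant S A').

Lemma commutant_comp : commutant S (A \o A').
Proof.
have [Ab AS] := cA; have [Ab' AS'] := cA'.
split=> [|l x /=]; first exact: bounded_operator_comp.
by rewrite !(AS' l x).1 !(AS' l x).2 !(AS l _).1 !(AS l _).2.
Qed.

Lemma compression_cvg x :
  (fun m => word_proj m (A (word_proj m (word_proj m (A' (word_proj m x))))))
    @ \oo --> A (A' x).
Proof.
apply: word_proj_cvg_seq; apply: bounded_operator_cvg; first exact: cA.1.
apply: word_proj_cvg_seq; apply: word_proj_cvg_seq.
by apply: bounded_operator_cvg; [exact: cA'.1 | exact: word_proj_cvg].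
Qed.

(** Each summand becomes [J (S l (Sa l (A (iota x))))], since [A] commutes with [Sa l]; the Cuntz
    relation sums them. *)
Lemma compression_fixed : fixed_operators V (J \o A \o iota).
Proof.
have [Ab AS] := cA; split=> [|x /=].
  apply: bounded_operator_comp; last first.
    by have [[? iso] _ _ _] := dil; split=> //; exists 1 => x; rewrite iso mul1r.
  exact: bounded_operator_comp bounded_adj_iota Ab.
under eq_bigr => l _ do rewrite -adj_iota_S -Sa_iota (AS _ _).2.
by rewrite -(linear_fun_sum linJ) sumSSa.
Qed.

(** For the empty word, [iota \o J] is [word_proj 0]. In the step, [S l] moves left past [A] and
    [Sa l] moves right past [A'], leaving the recursion of [word_proj] between them. *)
Lemma word_sum_compression m k :
  \sum_(w : m.-tuple Lam)
    word V w (J (A (iota (J (A' (iota (adj (word V w) k))))))) =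
  J (A (word_proj m (A' (iota k)))).
Proof.
have [Ab AS] := cA; have [Ab' AS'] := cA'; elim: m k => [|m IH] k.
  rewrite (big_pred1 [tuple]) => [|w]; last exact/esym/eqP/tuple0.
  by rewrite /= (adj_eq (@is_adj_id _ K)).
rewrite (word_sum_cons m (fun x => J (A (iota (J (A' (iota x))))))).
under eq_bigr => l _ do
  rewrite IH -adj_iota_S -Sa_iota (AS' _ _).2 -(AS _ _).1.
by rewrite -(linear_fun_sum linJ) -(linear_fun_sum Ab.1).
Qed.

End Compression.

End Dilation.

(** * The product of two fixed operators as a strong limit *)

Theorem proposition3p4 (R : realType) (Lam : finType) (K H : hilbertType R[i])
    (V : Lam -> K -> K) (iota : K -> H) (S : Lam -> H -> H)
    (T T' : K -> K) (A A' : H -> H) :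
  (2 <= #|Lam|)%N ->
  row_coisometry V ->
  cuntz_dilation V iota S ->
  fixed_operators V T -> fixed_operators V T' ->
  commutant S A -> commutant S A' ->
  let PK := orth_proj (range iota) in
  let P m := orth_proj (word_space iota S m) in
  ext_op iota T = PK \o A \o PK ->
  ext_op iota T' = PK \o A' \o PK ->
  commutant S (A \o A') /\
  (forall xi : H,
     (fun m : nat => (P m \o A \o P m) ((P m \o A' \o P m) xi)) @ \oo
       --> A (A' xi)) /\
  exists TT' : K -> K,
    [/\ ext_op iota TT' = PK \o (A \o A') \o PK,
        fixed_operators V TT'
      & forall xi : K,
          (fun m : nat => \sum_(w : m.-tuple Lam)
             word V w (T (T' (adj (word V w) xi)))) @ \oo --> TT' xi].
Proof.
move=> _ [Vbnd _] dil _ _ cA cA' PK P.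
move=> /(ext_op_compression dil) -> /(ext_op_compression dil) ->.
have cAA := commutant_comp cA cA'.
split=> //; split=> [xi|].
  rewrite /P /comp.
  under eq_fun => m do rewrite !(orth_proj_word_space dil).
  exact: (compression_cvg dil cA cA').
(* The product of [T] and [T'] is the compression of [A \o A'], so the results on one commutant
   element apply to it. *)
exists (adj iota \o (A \o A') \o iota); split.
- exact/(ext_op_compression dil).
- exact: (compression_fixed Vbnd dil).
move=> xi /=.
under eq_fun => m do rewrite (word_sum_compression Vbnd dil cA cA').
(* Only the projection depends on [m]: stripping the bounded [adj iota] and [A] leaves its strong
   convergence at [A' (iota xi)]. *)
apply: bounded_operator_cvg; first exact: (bounded_adj_iota dil).
apply: bounded_operator_cvg; first exact: cA.1.
exact: (@word_proj_cvg _ _ _ _ _ _ _ dil).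
Qed.
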